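(* For every $n\ge1$ and $\lambda\vdash n$, $$s_\lambda\!\left[\frac{1}{(1-q_1)(1-q_2)\cdots}\right]=\frac{\sum_{T\in\mathrm{SYT}(\lambda)}\sum_{\vec{\sigma}\in {}_{\mathrm{des}(T)}S_n^{\infty}} Q^{\mathrm{Comaj}_{\mathrm{des}(T)}(\vec{\sigma})}}{\prod_{i\ge1}(q_i;q_i)_n}.$$
   Context: The left side is $s_\lambda$ evaluated at all monomials in the countably many variables $q_1,q_2,\dots$ (equivalently $s_\lambda$ plethystically evaluated at $\sum_{i\ge0}h_i[q_1+q_2+\cdots]$). $(q;t)_r=(1-q)(1-qt)\cdots(1-qt^{r-1})$. $\mathrm{SYT}(\lambda)$: standard Young tableaux of shape $\lambda$; $\epsilon$: identity of $S_n$. For a standard tableau $T$ with $n$ cells, $\mathrm{des}(T)$ is the set of $i$ such that $i+1$ lies in a strictly lower row than $i$ (English notation). Definitions. $\mathbb{N}=\{0,1,\dots\}$; sequences in $\mathbb{N}^r$ are compared lexicographically. For $R\subseteq\{1,\dots,n-1\}$ and distinct $a,b$, write $a\sim_R b$ if all of $\min(a,b),\dots,\max(a,b)-1$ lie in $R$. For $S=(s^1,\dots,s^n)\in(\mathbb{N}^r)^n$ (if $r=0$ all $s^i$ are empty and equal) and $\sigma\in S_n$, $\mathrm{Des}_{R,S}(\sigma)$ is the set of $i\in\{1,\dots,n-1\}$ with either $s^{\sigma_i}>s^{\sigma_{i+1}}$, or $s^{\sigma_i}=s^{\sigma_{i+1}}$ and either ($\sigma_{i+1}<\sigma_i$ and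 not $\sigma_{i+1}\sim_R\sigma_i$) or ($\sigma_{i+1}>\sigma_i$ and $\sigma_i\sim_R\sigma_{i+1}$). $\mathrm{Comaj}_{R,S}(\sigma)=\sum_{i\in\mathrm{Des}_{R,S}(\sigma)}(n-i)$. $Z_{R,\sigma}(S)\in(\mathbb{N}^{r+1})^n$ prepends to each $s^j$ a first coordinate $z^j_1$ with $z^{\sigma_i}_1=\#\{j<i:j\in\mathrm{Des}_{R,S}(\sigma)\}$. For $\vec{\pi}=(\pi^1,\dots,\pi^{k-1})\in S_n^{\times(k-1)}$ ($k\ge1$), set $\pi^k=\epsilon$, $Z^0=$ list of $n$ empty sequences, $Z^i=Z_{R,\pi^i}(Z^{i-1})$, $\mathrm{comaj}^i_R(\vec{\pi})=\mathrm{Comaj}_{R,Z^{i-1}}(\pi^i)$, $1\le i\le k$. Let $\tau_R\in S_n$ be the unique permutation with $\mathrm{Comaj}_{R,\emptyset}(\tau_R)=0$, where $\emptyset$ denotes the list of $n$ empty sequences. ${}_RS_n^\infty$ is the set of infinite sequences $\vec{\sigma}=(\sigma^1,\sigma^2,\dots)$ in $S_n$ with $\sigma^1=\epsilon$ and $\sigma^i=\tau_R$ for all sufficiently large $i$. For such $\vec\sigma$ let $m\ge1$ be smallest such that $\sigma^i=\tau_R$ for all $i>m$, and set $Q^{\mathrm{Comaj}_R(\vec{\sigma})}=\prod_{j=1}^m q_j^{\mathrm{comaj}^{m-j+1}_R(\sigma^m,\sigma^{m-1},\dots,\sigma^2)}$ (here $(\sigma^m,\dots,\sigma^2)$ is an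 $(m-1)$-tuple, empty if $m=1$). *)

(* Defs.v *)
From mathcomp Require Import all_boot.

Set Implicit Arguments.
Unset Strict Implicit.
Unset Printing Implicit Defensive.

Definition is_partition (n : nat) (lam : seq nat) : bool :=
  [&& sorted geq lam, all (fun x => 0 < x) lam & sumn lam == n].

(* Monomials in q_1, q_2, ... : exponent sequences (e_1, e_2, ...).    *)
(* A monomial is represented canonically by its exponent sequence with *)
(* trailing zeros removed; [::] is the monomial 1.                     *)

Fixpoint trim (s : seq nat) : seq nat :=
  match s with
  | [::] => [::]
  | x :: s' => let t := trim s' in
               if (x == 0) && (t == [::]) then [::] else x :: t
  end.

Definition canon (s : seq nat) : bool := trim s == s.

Fixpoint madd (a b : seq nat) : seq nat :=
  match a, b with
  | [::], _ => b
  | _, [::] => a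
  | x :: a', y :: b' => (x + y) :: madd a' b'
  end.

Definition meq (a b : seq nat) : bool := trim a == trim b.

Fixpoint lex_lt (a b : seq nat) : bool :=
  match a, b with
  | [::], [::] => false
  | [::], _ :: _ => true
  | _ :: _, [::] => false
  | x :: a', y :: b' => (x < y) || ((x == y) && lex_lt a' b')
  end.

(* Tableaux, as lists of rows (English notation, rows/cols 0-based).  *)

Definition entry (T : Type) (x0 : T) (t : seq (seq T)) (i j : nat) : T :=
  nth x0 (nth [::] t i) j.

Definition cols_strict (T : Type) (x0 : T) (lt : T -> T -> bool)
    (t : seq (seq T)) : bool :=
  all (fun i => all (fun j => lt (entry x0 t i j) (entry x0 t i.+1 j))
                    (iota 0 (size (nth [::] t i.+1))))
      (iota 0 (size t).-1).

Definition ssyt_mono (lam : seq nat) (t : seq (seq (seq nat))) : bool :=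
  [&& map size t == lam,
      all (fun row => all canon row) t,
      all (fun row => sorted (fun a b => ~~ lex_lt b a) row) t &
      cols_strict [::] lex_lt t].

Definition ssyt_weight (t : seq (seq (seq nat))) : seq nat :=
  foldr madd [::] (flatten t).

(** Coefficient of q^beta in s_lam[1/((1-q_1)(1-q_2)...)] = number of
    semistandard tableaux of shape lam with monomial entries whose product is
    q^beta (s_lam evaluated at the alphabet of all monomials, incl. 1). *)
Definition lhs_pred (lam : seq nat) (beta : seq nat) (t : seq (seq (seq nat))) : bool :=
  ssyt_mono lam t && meq (ssyt_weight t) beta.

Definition syt (n : nat) (lam : seq nat) (t : seq (seq nat)) : bool :=
  [&& map size t == lam,
      perm_eq (flatten t) (iota 1 n),
      all (sorted ltn) t &
      cols_strict 0 ltn t].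

Definition rowof (t : seq (seq nat)) (v : nat) : nat :=
  find (fun row => v \in row) t.

Definition des (n : nat) (t : seq (seq nat)) : pred nat :=
  fun i => (0 < i < n) && (rowof t i < rowof t i.+1).

(* Permutations of {1..n} in one-line notation: sg = [:: s_1; ...; s_n] *)
(* Lists S = (s^1,...,s^n) as seq (seq nat), s^v = nth [::] S v.-1.    *)

Definition is_perm (n : nat) (sg : seq nat) : bool := perm_eq sg (iota 1 n).

Definition simR (R : pred nat) (a b : nat) : bool :=
  all R (iota (minn a b) (maxn a b - minn a b)).

Definition DesRS (R : pred nat) (n : nat) (S : seq (seq nat)) (sg : seq nat)
    : seq nat :=
  [seq i <- iota 1 n.-1 |
     let a := nth 0 sg i.-1 in
     let b := nth 0 sg i in
     let sa := nth [::] S a.-1 in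
     let sb := nth [::] S b.-1 in
     lex_lt sb sa ||
     ((sa == sb) && (((b < a) && ~~ simR R b a) || ((a < b) && simR R a b)))].

Definition ComajRS (R : pred nat) (n : nat) (S : seq (seq nat)) (sg : seq nat)
    : nat :=
  \sum_(i <- DesRS R n S sg) (n - i).

(** Z_{R,sg}(S): prepend z^{sg_i} = #{ j < i : j in Des_{R,S}(sg) } *)
Definition Zmap (R : pred nat) (n : nat) (S : seq (seq nat)) (sg : seq nat)
    : seq (seq nat) :=
  [seq count (fun j => j < (index v sg).+1) (DesRS R n S sg) :: nth [::] S v.-1
  | v <- iota 1 n].

Fixpoint comajs (R : pred nat) (n : nat) (Z : seq (seq nat))
    (pis : seq (seq nat)) : seq nat :=
  match pis with
  | [::] => [::]
  | p :: ps => ComajRS R n Z p :: comajs R n (Zmap R n Z p) ps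
  end.

(** for pis = (pi^1,...,pi^{k-1}), returns [:: comaj^1_R; ...; comaj^k_R]
    (with pi^k = identity and Z^0 = n empty sequences) *)
Definition comaj_vec (R : pred nat) (n : nat) (pis : seq (seq nat)) : seq nat :=
  comajs R n (nseq n [::]) (rcons pis (iota 1 n)).

(** sg = tau_R, i.e. sg is the (unique) permutation with Comaj_{R,empty} = 0 *)
Definition is_tau (R : pred nat) (n : nat) (sg : seq nat) : bool :=
  is_perm n sg && (ComajRS R n (nseq n [::]) sg == 0).

(** Encoding of _R S_n^infty: a sequence (eps, s^2, s^3, ...) with s^i = tau_R
    for large i is encoded by the finite list L = [:: s^2; ...; s^m] where m is
    the least index >= 1 with s^i = tau_R for all i > m (so L is empty iff
    m = 1, and otherwise its last element is not tau_R). This is a bijection. *)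
Definition validL (R : pred nat) (n : nat) (L : seq (seq nat)) : bool :=
  all (is_perm n) L &&
  (if L is [::] then true else ~~ is_tau R n (last [::] L)).

(** Q^{Comaj_R(sigma)} = prod_{j=1}^m q_j^{comaj^{m-j+1}_R(s^m,...,s^2)},
    as an exponent sequence (e_1,...,e_m). *)
Definition Qmono (R : pred nat) (n : nat) (L : seq (seq nat)) : seq nat :=
  rev (comaj_vec R n (rev L)).

(** Expansion of 1 / prod_{i>=1} (q_i;q_i)_n
      = prod_{i>=1} prod_{k=1}^n sum_{j>=0} q_i^{k j}:
    a term is a finitely supported family (j_{i,k})_{i>=1, 1<=k<=n}, encoded
    as the list of rows [:: j_{i,1}; ...; j_{i,n}] for i = 1, 2, ..., with
    trailing all-zero rows removed; its monomial has exponent of q_i equal to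
    sum_k k * j_{i,k}. *)
Definition validJ (n : nat) (J : seq (seq nat)) : bool :=
  all (fun r => size r == n) J &&
  (if J is [::] then true else has (fun x => x != 0) (last [::] J)).

Definition Jmono (n : nat) (J : seq (seq nat)) : seq nat :=
  [seq \sum_(k < n) k.+1 * nth 0 r k | r <- J].

(** Coefficient of q^beta in the right-hand side: triples (T, sigma, J) with
    T in SYT(lam), sigma in _{des T} S_n^infty, J a term of the expansion of
    1/prod_i (q_i;q_i)_n, such that Q^{Comaj_{des T}(sigma)} * q^J = q^beta. *)
Definition rhs_pred (n : nat) (lam : seq nat) (beta : seq nat)
    (x : seq (seq nat) * seq (seq nat) * seq (seq nat)) : bool :=
  let: (T, L, J) := x in
  [&& syt n lam T, validL (des n T) n L, validJ n J &
      meq (madd (Qmono (des n T) n L) (Jmono n J)) beta].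

Definition has_card (T : eqType) (P : pred T) (c : nat) : Prop :=
  exists s : seq T, [/\ uniq s, forall x, P x = (x \in s) & size s = c].

(* Main.v *)
Require Import Defs.
From mathcomp Require Import all_boot zify.

(** Standardization writes a semistandard tableau as a pair (T, W), where T is
    a standard tableau and W = (w_1 <= ... <= w_n) is a list of monomials that
    increases strictly at the descents R of T.  View W as an n-rowed matrix of
    exponents and let s_j be the order of the indices 1, ..., n given by the
    columns j, j+1, ..., with ties broken by the order tau_R; then s_j = tau_R
    for large j, and the condition on W says that s_1 is the identity.  Relative
    to s_(j+1), column j is an arbitrary vector, and it is determined by the
    permutation s_j sorting it stably and by its excess over the smallest vector
    sorted by s_j.  That smallest vector has sum comaj (s_(j+1)^-1 s_j), which
    is the exponent of q_j in Q^Comaj, and the excess is a partition with at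
    most n parts, counted by 1/(q_j; q_j)_n.  The minimal vectors induce the
    same orders as the actual columns, so the recursive definition of Comaj only
    sees consecutive permutations s_(j+1), s_j. *)

Set Implicit Arguments.
Unset Strict Implicit.
Unset Printing Implicit Defensive.

(** * Counting through bijections and finite supersets *)

Lemma has_card_bij (T U : eqType) (P : pred T) (Q : pred U) (f : U -> T) c :
  (forall y, Q y -> P (f y)) -> {in Q &, injective f} ->
  (forall x, P x -> exists2 y, Q y & f y = x) -> has_card P c -> has_card Q c.
Proof.
move=> fQP f_inj f_surj [s [us sP <-]].
(* No inverse of [f] is given, so [Q] is enumerated by choosing one preimage for each element of the
   list; this form of the claim allows induction on [s]. *)
suff [s' [us' s'Q ss']]: exists s', [/\ uniq s',
    forall y, (y \in s') = Q y && (f y \in s) & size s' = size s].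
  exists s'; split=> // y; rewrite s'Q -sP.
  by case Qy: (Q y); rewrite //= fQP.
have: all P s by apply/allP=> x; rewrite -sP.
elim: s us {sP} => [_ _|x s IHs /= /andP[xs us] /andP[Px Ps]].
  by exists [::]; split=> // y; rewrite in_nil andbF.
have [s' [us' s'Q <-]] := IHs us Ps.
have [y Qy fy] := f_surj x Px.
exists (y :: s'); split=> //=; first by rewrite s'Q fy negb_and xs orbT.
move=> z; rewrite !inE s'Q; case Qz: (Q z); last first.
  by rewrite orbF; apply: contraFF Qz => /eqP->.
by congr orb; rewrite -fy; apply/eqP/eqP=> [->|/f_inj->].
Qed.

Lemma has_card_sub (T : eqType) (P : pred T) (s : seq T) :
  {subset P <= s} -> exists c, has_card P c.
Proof.
move=> Ps; exists (size (filter P (undup s))), (filter P (undup s)); split=> //.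
  by rewrite filter_uniq ?undup_uniq.
by move=> x; rewrite mem_filter mem_undup; case Px: (P x); rewrite // Ps.
Qed.

Fixpoint words (T : Type) (s : seq T) (k : nat) : seq (seq T) :=
  if k is k'.+1 then [::] :: [seq x :: w | x <- s, w <- words s k']
  else [:: [::]].

Lemma mem_words (T : eqType) (s : seq T) k w :
  size w <= k -> {subset w <= s} -> w \in words s k.
Proof.
elim: k w => [|k IHk] [|x w] //= lek ws.
rewrite inE; apply/orP; right; apply/allpairsP; exists (x, w); split=> //=.
  by apply: ws; rewrite mem_head.
by apply: IHk => // y yw; apply: ws; rewrite inE yw orbT.
Qed.

(** * Sorting by a strict order *)

Lemma sorted_index (T : eqType) (r : rel T) (s : seq T) :
  transitive r -> irreflexive r -> sorted r s ->
  {in s &, forall a b, r a b = (index a s < index b s)}.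
Proof.
move=> r_trans r_irr rs a b sa sb.
have ltr := sorted_ltn_index r_trans rs.
apply/idP/idP=> [rab|]; last exact: ltr.
case: ltngtP => // [|/(index_inj a sa sb) eab].
  by move=> /(ltr _ _ sb sa) /(r_trans _ _ _ rab); rewrite r_irr.
by rewrite eab r_irr in rab.
Qed.

(** The strict relation is closed reflexively because sorting needs a total relation; on a list
    without repetitions the result is still strictly increasing. *)
Definition strict_sort (T : eqType) (r : rel T) : seq T -> seq T :=
  sort (fun a b => (a == b) || r a b).

Lemma strict_sortP (T : eqType) (r : rel T) (s : seq T) :
  transitive r -> {in s &, forall a b, a != b -> r a b || r b a} ->
  uniq s -> sorted r (strict_sort r s).
Proof.
rewrite /strict_sort => r_trans r_total us; set le := fun a b => _.
have le_trans : transitive le.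
  move=> b a d /orP[/eqP->//|rab] /orP[/eqP<-|rbd]; first by rewrite /le rab orbT.
  by rewrite /le (r_trans _ _ _ rab rbd) orbT.
have: sorted le (sort le s).
  apply: (@sort_sorted_in _ (mem s)); last by apply/allP.
  move=> a b sa sb; rewrite /= /le; case: eqVneq => //= nab.
  exact: r_total.
rewrite !sorted_pairwise //.
case Ds: (sort le s) => [|x0 s1] // /(pairwiseP x0) pw.
apply/(pairwiseP x0) => i j i_lt j_lt ij.
have /orP[|//] := pw i j i_lt j_lt ij.
by rewrite nth_uniq -?Ds ?sort_uniq ?Ds //; move: ij; lia.
Qed.

(** * Lexicographic order and exponent sequences *)

Lemma lex_lt_irr : irreflexive lex_lt.
Proof. by elim=> //= x s ->; rewrite ltnn eqxx. Qed.

Lemma lex_lt_trans : transitive lex_lt.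
Proof.
elim=> [|y b IHb] [|x a] [|z d] //= /orP[xy|/andP[/eqP-> ab]].
  by case/orP=> [yz|/andP[/eqP<- _]]; rewrite ?xy // (ltn_trans xy yz).
by case/orP=> [->//|/andP[/eqP-> bd]]; rewrite eqxx (IHb a d) ?orbT.
Qed.

Lemma lex_lt_total a b : a != b -> lex_lt a b || lex_lt b a.
Proof.
elim: a b => [|x a IHa] [|y b] //=; rewrite eqseq_cons.
by case: ltngtP => //= _ /IHa.
Qed.

Lemma nth_trim s j : nth 0 (trim s) j = nth 0 s j.
Proof.
elim: s j => [|x s IHs] //= j.
case: ifP => [/andP[/eqP-> /eqP ts]|_]; case: j => //= j.
by rewrite -IHs ts nth_nil.
Qed.

Lemma trim_ext a b : nth 0 a =1 nth 0 b -> trim a = trim b.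
Proof.
have trim0 s : (forall j, nth 0 s j = 0) -> trim s = [::].
  by elim: s => //= x s IHs s0; rewrite (s0 0 : x = 0) (IHs (fun j => s0 j.+1)).
elim: a b => [|x a IHa] [|y b] // eab.
- by apply/esym/trim0 => j; rewrite -eab nth_nil.
- by apply: trim0 => j; rewrite eab nth_nil.
- by rewrite /= (IHa b (fun j => eab j.+1)) (eab 0 : x = y).
Qed.

Lemma trim_id s : trim (trim s) = trim s.
Proof. exact/trim_ext/nth_trim. Qed.

Lemma meqP a b : reflect (nth 0 a =1 nth 0 b) (meq a b).
Proof.
apply: (iffP eqP) => [eab j|]; last exact: trim_ext.
by rewrite -nth_trim eab nth_trim.
Qed.

(** A nonempty trimmed list contains a nonzero entry, so a proper extension of a trimmed list is
    also larger after padding with zeros. Equal sizes matter: [[::]] and [[:: 0]] have the same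
    trim. *)
Lemma lex_lt_trim a b : size a = size b -> lex_lt (trim a) (trim b) = lex_lt a b.
Proof.
elim: a b => [|x a IHa] [|y b] //= [/IHa <-].
by case: (trim a) => [|u ta]; case: (trim b) => [|v tb]; case: x y => [|x] [|y].
Qed.

Lemma eq_trim a b : size a = size b -> (trim a == trim b) = (a == b).
Proof.
move=> sab; apply/eqP/eqP=> [eab|-> //].
by apply: (@eq_from_nth _ 0) => // j _; rewrite -nth_trim eab nth_trim.
Qed.

Lemma nth_madd a b j : nth 0 (madd a b) j = nth 0 a j + nth 0 b j.
Proof.
elim: a b j => [|x a IHa] [|y b] [|j] //=; rewrite ?addn0 //.
Qed.

Lemma nth_foldr_madd s j : nth 0 (foldr madd [::] s) j = \sum_(w <- s) nth 0 w j.
Proof.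
elim: s => [|w s IHs]; first by rewrite big_nil nth_nil.
by rewrite big_cons /= nth_madd IHs.
Qed.

(** * Finitely supported sequences as lists *)

Section FiniteSupport.
Variables (T : eqType) (d : T).

(** If one list were longer, its last entry, which is not [d], would face the default of the other.
    This serves [L], with default [tau], and [J], with default the zero row. *)
Lemma finsupp_eq (s s' : seq T) :
  (s == [::]) || (last d s != d) -> (s' == [::]) || (last d s' != d) ->
  nth d s =1 nth d s' -> s = s'.
Proof.
wlog ss' : s s' / size s <= size s'.
  move=> IH ns ns' e; case/orP: (leq_total (size s) (size s')) => l; first exact: IH.
  by rewrite (IH s' s).
move=> _ ns' e; apply: (@eq_from_nth _ d) => [|j _]; last exact: e.
apply/eqP; rewrite eqn_leq ss' /= leqNgt; apply/negP => lt_s.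
move: ns'; case: eqP => [s'0|_] /=; first by rewrite s'0 in lt_s.
by rewrite -nth_last -e nth_default ?eqxx //; move: lt_s; lia.
Qed.

Lemma finsupp_exists K (f : nat -> T) : (forall j, K <= j -> f j = d) ->
  exists2 s, (s == [::]) || (last d s != d) & nth d s =1 f.
Proof.
elim: K f => [|K IHK] f f_d; first by exists [::] => // j; rewrite nth_nil f_d.
(* Either the bound drops, or [K] is the last index of the support and the list of the first [K.+1]
   values does not end in [d]. *)
case: (eqVneq (f K) d) => [fK|fK].
  by apply: IHK => j; rewrite leq_eqVlt => /orP[/eqP<-|/f_d].
exists (mkseq f K.+1); first by rewrite -nth_last size_mkseq nth_mkseq ?fK ?orbT.
move=> j; case: (ltnP j K.+1) => jK; first by rewrite nth_mkseq.
by rewrite nth_default ?size_mkseq ?f_d.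
Qed.

End FiniteSupport.

(** ** Columns, permutations and descents *)

Definition tie (R : pred nat) (a b : nat) : bool :=
  ((b < a) && ~~ simR R b a) || ((a < b) && simR R a b).

(** [blk] numbers the classes of the relation [simR R], in increasing order. So [tie] follows the
    natural order between classes and the reversed one inside a class, which makes it a strict total
    order. *)
Lemma tieE R a b :
  let blk x := count (predC R) (iota 0 x) in
  tie R a b = (blk b < blk a) || ((blk b == blk a) && (a < b)).
Proof.
have simE x y : x < y -> simR R x y =
    (count (predC R) (iota 0 x) == count (predC R) (iota 0 y)) /\
    count (predC R) (iota 0 x) <= count (predC R) (iota 0 y).
  move=> xy; rewrite /simR (minn_idPl (ltnW xy)) (maxn_idPr (ltnW xy)).
  rewrite -{2 3}(subnKC (ltnW xy)) iotaD count_cat add0n leq_addr.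
  rewrite -{1}[count _ (iota 0 x)]addn0 eqn_add2l eq_sym -leqn0 leqNgt -has_count.
  by rewrite has_predC negbK.
rewrite /tie /=; case: ltngtP => [ab|ba|->].
- by have [-> ] := simE _ _ ab; case: ltngtP.
- by have [-> ] := simE _ _ ba; case: ltngtP.
- by rewrite ltnn eqxx.
Qed.

(** The condition that [DesRS] tests on consecutive entries. It is a strict total order on indices,
    so every [S] is sorted by exactly one permutation. *)
Definition gtS (R : pred nat) (S : nat -> seq nat) (a b : nat) : bool :=
  lex_lt (S b) (S a) || ((S a == S b) && tie R a b).

Lemma gtS_irr R S : irreflexive (gtS R S).
Proof. by move=> a; rewrite /gtS lex_lt_irr eqxx tieE /= ltnn eqxx ltnn. Qed.

Lemma gtS_trans R S : transitive (gtS R S).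
Proof.
move=> b a c; rewrite /gtS; case/orP=> [ba|/andP[/eqP-> tab]].
  case/orP=> [cb|/andP[/eqP<- _]]; first by rewrite (lex_lt_trans cb ba).
  by rewrite ba.
case/orP=> [-> //|/andP[/eqP-> tbc]]; rewrite eqxx; apply/orP; right.
by move: tab tbc; rewrite !tieE /=; lia.
Qed.

Lemma gtS_total R S a b : a != b -> gtS R S a b || gtS R S b a.
Proof.
move=> nab; rewrite /gtS; case: (eqVneq (S a) (S b)) => [->|/lex_lt_total].
  by rewrite lex_lt_irr !tieE /=; lia.
by case/orP=> ->; rewrite ?orbT.
Qed.

Lemma ltS_trans R S : transitive (fun a b => gtS R S b a).
Proof. by move=> b a c ba cb; apply: gtS_trans cb ba. Qed.

Lemma ltS_irr R S : irreflexive (fun a b => gtS R S b a).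
Proof. exact: gtS_irr. Qed.

(* [p] lists its elements in increasing order for [S], ties broken by [R]. *)
Definition compat R S p := sorted (fun a b => gtS R S b a) p.

Lemma compat_index R S p : compat R S p ->
  {in p &, forall a b, gtS R S b a = (index a p < index b p)}.
Proof. exact: sorted_index (@ltS_trans R S) (@ltS_irr R S). Qed.

Lemma compat_inj R S p p' : compat R S p -> compat R S p' -> p =i p' -> p = p'.
Proof.
by move=> sp sp' ep; apply: (irr_sorted_eq (@ltS_trans R S) (@ltS_irr R S) sp sp').
Qed.

Lemma eq_in_compat R S S' p : {in p, S =1 S'} -> compat R S p = compat R S' p.
Proof.
move=> eS; apply: (@eq_in_sorted _ (mem p)); last by apply/allP.
by move=> a b ap bp; rewrite /gtS !eS.
Qed.

Definition ordr (c : nat -> nat) (p : seq nat) (a b : nat) : bool :=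
  (c a < c b) || ((c a == c b) && (index a p < index b p)).

Lemma ordr_irr c p : irreflexive (ordr c p).
Proof. by move=> a; rewrite /ordr !ltnn andbF. Qed.

Lemma ordr_trans c p : transitive (ordr c p).
Proof. by move=> b a d; rewrite /ordr; lia. Qed.

Lemma ordr_total c p : {in p &, forall a b, a != b -> ordr c p a b || ordr c p b a}.
Proof.
move=> a b ap bp nab; rewrite /ordr.
have: index a p != index b p by apply: contraNneq nab => /(index_inj a ap bp)->.
lia.
Qed.

(** One step of radix sort: a new first coordinate is compared first, and ties fall back on the old
    order, which the positions in [p] record. *)
Lemma compat_cons R S p c s : compat R S p -> {subset s <= p} ->
  sorted (ordr c p) s -> compat R (fun v => c v :: S v) s.
Proof.
move=> Sp sp; apply: (@sub_in_sorted _ (mem s)); last by apply/allP.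
move=> a b /sp ap /sp bp; rewrite /ordr -(compat_index Sp ap bp) /gtS /= eqseq_cons.
case/orP=> [->//|/andP[/eqP->]]; rewrite eqxx ltnn /=.
by case/orP=> ->; rewrite ?orbT.
Qed.

(** * Columns sorted by one permutation relative to another *)

Section Perms.
Variable n : nat.
Implicit Types (p s L : seq nat).

Lemma is_perm_mem p : is_perm n p -> p =i iota 1 n.
Proof. exact: perm_mem. Qed.

Lemma is_perm_size p : is_perm n p -> size p = n.
Proof. by move/perm_size->; rewrite size_iota. Qed.

Lemma is_perm_uniq p : is_perm n p -> uniq p.
Proof. by move/perm_uniq->; rewrite iota_uniq. Qed.

Lemma is_perm_id : is_perm n (iota 1 n).
Proof. exact: perm_refl. Qed.

Lemma strict_sort_perm (r : rel nat) : is_perm n (strict_sort r (iota 1 n)).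
Proof. by rewrite /is_perm perm_sort perm_refl. Qed.

Lemma ordr_sort c p : is_perm n p ->
  sorted (ordr c p) (strict_sort (ordr c p) (iota 1 n)).
Proof.
move=> pp; apply: strict_sortP (iota_uniq 1 n); first exact: ordr_trans.
by move=> a b; rewrite -!(is_perm_mem pp); apply: ordr_total.
Qed.

Lemma ordr_inj c p s s' : is_perm n s -> is_perm n s' ->
  sorted (ordr c p) s -> sorted (ordr c p) s' -> s = s'.
Proof.
move=> ps ps' ss ss'; apply: irr_sorted_eq ss ss' _; first exact: ordr_trans.
  exact: ordr_irr.
by move=> x; rewrite !is_perm_mem.
Qed.

Lemma ordr_refl c p : is_perm n p -> {in p &, forall a b, c a = c b} ->
  sorted (ordr c p) p.
Proof.
move=> pp c0; apply/(sortedP 0) => i ip; rewrite /ordr.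
rewrite (c0 (nth 0 p i) (nth 0 p i.+1)) ?mem_nth //; last exact: ltnW.
by rewrite eqxx !index_uniq ?(is_perm_uniq pp) ?ltnSn ?orbT //; exact: ltnW.
Qed.

(** For [i > 0] this is a descent of the permutation p^-1 s at the one-based position [i]. At
    [i = 0] an entry is compared with itself, so the value is [false] and sums may start at 0. *)
Definition delta p s i : bool := index (nth 0 s i) p < index (nth 0 s i.-1) p.

Definition comaj p s := \sum_(i < n) delta p s i * (n - i).

(* [column p s r] is the least column sorted by [s] relative to [p] plus a
   partition with [nth 0 r k] parts of size [k.+1]. *)
Definition column p s r v :=
  \sum_(i < (index v s).+1) (delta p s i + nth 0 r (n - i.+1)).

Lemma column_nth p s r i : is_perm n s -> i < n ->
  column p s r (nth 0 s i) = \sum_(k < i.+1) (delta p s k + nth 0 r (n - k.+1)).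
Proof.
by move=> ps i_n; rewrite /column index_uniq ?(is_perm_uniq ps) ?(is_perm_size ps).
Qed.

(** Along [s] the column grows by at least [delta], so equal neighbours are not descents and appear
    in the order of [p]. *)
Lemma column_sorted p s r : is_perm n p -> is_perm n s ->
  sorted (ordr (column p s r) p) s.
Proof.
move=> pp ps; apply/(sortedP 0) => i; rewrite (is_perm_size ps) => i_n.
rewrite /ordr !column_nth //; last exact: ltnW.
rewrite (big_ord_recr i.+1) /= /delta /=.
have: index (nth 0 s i) p != index (nth 0 s i.+1) p.
  have mem j : j < n -> nth 0 s j \in p.
    by move=> jn; rewrite (is_perm_mem pp) -(is_perm_mem ps) mem_nth ?(is_perm_size ps).
  apply/eqP => /(index_inj 0 (mem _ (ltnW i_n)) (mem _ i_n))/eqP.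
  by rewrite nth_uniq ?(is_perm_uniq ps) ?(is_perm_size ps) //; lia.
set x := index _ _; set y := index _ _; lia.
Qed.

Lemma sum_prefix (x : nat -> nat) m :
  \sum_(i < m) \sum_(k < i.+1) x k = \sum_(k < m) x k * (m - k).
Proof.
elim: m => [|m IHm]; first by rewrite !big_ord0.
rewrite big_ord_recr /= IHm [RHS]big_ord_recr /= big_ord_recr /= subSnn muln1.
rewrite addnA -big_split /=; congr (_ + _); apply: eq_bigr => i _.
by rewrite subSn ?mulnS 1?addnC // ltnW.
Qed.

(** A unit step at position [i] raises the [n - i] entries from there on. A descent thus contributes
    its weight in [comaj], and an entry of [r] counts parts of that size; this is why [column] reads
    [r] backwards. *)
Lemma sum_column p s r : is_perm n s ->
  \sum_(v <- iota 1 n) column p s r v =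
  comaj p s + \sum_(k < n) k.+1 * nth 0 r k.
Proof.
move=> ps; rewrite -(perm_big _ ps) /= (big_nth 0) (is_perm_size ps) big_mkord.
under [LHS]eq_bigr do rewrite column_nth //.
rewrite (sum_prefix (fun k => delta p s k + nth 0 r (n - k.+1))).
under [LHS]eq_bigr do rewrite mulnDl.
rewrite big_split /=; congr (_ + _); rewrite (reindex_inj rev_ord_inj) /=.
by apply: eq_bigr => k _; rewrite mulnC; congr (_ * nth 0 r _); move: (ltn_ord k); lia.
Qed.

(** The differences of the column along [s] are [delta] plus an entry of [r], and [delta] does not
    depend on [r]. *)
Lemma column_inj p s r r' : is_perm n s -> size r = n -> size r' = n ->
  {in iota 1 n, column p s r =1 column p s r'} -> r = r'.
Proof.
move=> ps sr sr' er; apply: (@eq_from_nth _ 0); rewrite sr // => k k_n.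
have mem i : i < n -> nth 0 s i \in iota 1 n.
  by move=> i_n; rewrite -(is_perm_mem ps) mem_nth ?(is_perm_size ps).
have lt_nk : n - k.+1 < n by lia.
have := er _ (mem _ lt_nk); rewrite /= !column_nth //.
rewrite !big_ord_recr /= (_ : n - (n - k.+1).+1 = k); last lia.
case Dm: (n - k.+1) => [|m]; first by rewrite !big_ord0 !add0n => /addnI.
have lt_m : m < n by lia.
by have := er _ (mem _ lt_m); rewrite /= !column_nth // => -> /addnI/addnI.
Qed.

(** The solution [r] of [column n p s r = c]: each step of [c] along [s], minus the forced step
    [delta]. The truncated subtractions are exact once [c] is sorted by [s] relative to [p]. *)
Definition increments (c : nat -> nat) p s :=
  let g i := c (nth 0 s i) - (if i is i'.+1 then c (nth 0 s i') else 0) - delta p s i in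
  mkseq (fun k => g (n - k.+1)) n.

Lemma column_increments c p s : is_perm n s -> sorted (ordr c p) s ->
  {in iota 1 n, column p s (increments c p s) =1 c}.
Proof.
move=> ps /(sortedP 0); rewrite (is_perm_size ps) => ss.
move=> v; rewrite -(is_perm_mem ps) => /(nthP 0)[i]; rewrite (is_perm_size ps) => i_n <-.
rewrite column_nth //.
elim: i i_n => [|i IHi] i_n; rewrite big_ord_recr /= nth_mkseq; try lia.
  by rewrite (_ : n - (n - 1).+1 = 0) ?big_ord0 /delta ?ltnn; lia.
rewrite IHi ?(ltnW i_n) // (_ : n - (n - i.+2).+1 = i.+1); last lia.
by have := ss i i_n; rewrite /ordr /delta /=; lia.
Qed.

End Perms.

(** * Descents relative to the previous permutation *)

Definition nthS (Z : seq (seq nat)) (v : nat) : seq nat := nth [::] Z v.-1.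

(** Without columns to compare only [tie] decides; [is_tauE] identifies the result with tau_R. *)
Definition tau R n := strict_sort (fun a b => gtS R (fun=> [::]) b a) (iota 1 n).

Section Comaj.
Variables (R : pred nat) (n : nat).
Hypothesis n_gt0 : 0 < n.
Implicit Types (p s : seq nat) (L Z : seq (seq nat)).

Lemma tau_perm : is_perm n (tau R n).
Proof. exact: strict_sort_perm. Qed.

Lemma tau_compat : compat R (fun=> [::]) (tau R n).
Proof.
apply: strict_sortP (iota_uniq 1 n); first exact: ltS_trans.
by move=> a b _ _ nab; apply: gtS_total; rewrite eq_sym.
Qed.

(** The weights [n - i] are positive, so [comaj] vanishes only if there are no descents, and then
    [s] lists the indices in the order of [p]. *)
Lemma comaj_eq0 p s : is_perm n p -> is_perm n s -> (comaj n p s == 0) = (s == p).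
Proof.
move=> pp ps; apply/idP/eqP => [|->].
  rewrite sum_nat_eq0 => /forallP d0.
  apply: (@ordr_inj n (fun=> 0) p) => //; last exact: (ordr_refl pp).
  apply/(sortedP 0) => i; rewrite (is_perm_size ps) => i_n.
  have /= := d0 (Ordinal i_n); rewrite /ordr ltnn eqxx /= muln_eq0 /delta /=.
  have: index (nth 0 s i) p != index (nth 0 s i.+1) p.
    have mem j : j < n -> nth 0 s j \in p.
      by move=> jn; rewrite (is_perm_mem pp) -(is_perm_mem ps) mem_nth ?(is_perm_size ps).
    apply/eqP => /(index_inj 0 (mem _ (ltnW i_n)) (mem _ i_n))/eqP.
    by rewrite nth_uniq ?(is_perm_uniq ps) ?(is_perm_size ps) //; lia.
  by set x := index _ _; set y := index _ _; lia.
rewrite sum_nat_eq0; apply/forallP => i /=.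
have := ltn_ord i; rewrite /delta => i_n.
by rewrite !index_uniq ?(is_perm_uniq pp) ?(is_perm_size pp); lia.
Qed.

(** As [p] sorts [Z], the descent condition just compares positions in [p]: the descent set depends
    on [Z] only through [p]. *)
Lemma DesRS_delta Z p s : is_perm n p -> is_perm n s -> compat R (nthS Z) p ->
  DesRS R n Z s = [seq i <- iota 1 n.-1 | delta p s i].
Proof.
move=> pp ps Zp; apply: eq_in_filter => i; rewrite mem_iota => i_n.
have mem j : j < n -> nth 0 s j \in p.
  by move=> jn; rewrite (is_perm_mem pp) -(is_perm_mem ps) mem_nth ?(is_perm_size ps).
by rewrite /delta -(compat_index Zp) ?mem //; lia.
Qed.

Lemma ComajRS_comaj Z p s : is_perm n p -> is_perm n s -> compat R (nthS Z) p ->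
  ComajRS R n Z s = comaj n p s.
Proof.
move=> pp ps Zp; rewrite /ComajRS (DesRS_delta pp ps Zp) big_filter big_mkcond.
rewrite /comaj -(big_mkord xpredT (fun i => delta p s i * (n - i))) big_ltn //.
rewrite /delta ltnn mul0n add0n /index_iota subn1.
by apply: eq_bigr => i _; case: ifP; rewrite ?mul1n ?mul0n.
Qed.

Lemma nthS_nseq : nthS (nseq n [::]) =1 fun=> [::].
Proof. by move=> v; rewrite /nthS nth_nseq if_same. Qed.

Lemma is_tauE s : is_tau R n s = (s == tau R n).
Proof.
rewrite /is_tau; case ps: (is_perm n s) => /=; last first.
  by apply/esym/eqP=> s_tau; rewrite s_tau tau_perm in ps.
rewrite (@ComajRS_comaj _ (tau R n)) ?comaj_eq0 ?tau_perm //.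
by rewrite (eq_in_compat R (in1W nthS_nseq)) tau_compat.
Qed.

(** The coordinate that [Zmap] prepends is the minimal column [column n p s [::]], which is sorted
    by [s]; so [s] takes over the role of [p] in the next step. *)
Lemma Zmap_compat Z p s : is_perm n p -> is_perm n s -> compat R (nthS Z) p ->
  compat R (nthS (Zmap R n Z s)) s.
Proof.
move=> pp ps Zp.
rewrite (@eq_in_compat _ _ (fun v => column n p s [::] v :: nthS Z v)).
  apply: (compat_cons Zp); last exact: column_sorted.
  by move=> v; rewrite (is_perm_mem ps) (is_perm_mem pp).
move=> v sv; have i_n : index v s < n by rewrite -(is_perm_size ps) index_mem.
move: (sv); rewrite (is_perm_mem ps) mem_iota => v_n.
rewrite /nthS /Zmap (nth_map 0) ?size_iota ?nth_iota; try lia.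
rewrite (_ : 1 + v.-1 = v); last lia.
rewrite (DesRS_delta pp ps Zp) /column; congr (_ :: _).
(* The entry [v] has one-based position [(index v s).+1], so exactly the descents from 1 to
   [index v s] are counted. *)
rewrite count_filter (_ : n.-1 = index v s + (n.-1 - index v s)); last lia.
have delta0: delta p s 0 = false by rewrite /delta ltnn.
rewrite iotaD count_cat big_ord_recl /= delta0 nth_nil add0n.
rewrite [X in _ + X = _](@eq_in_count _ _ pred0) ?count_pred0 ?addn0; last first.
  by move=> i; rewrite mem_iota /=; case: ltnP => //=; lia.
rewrite -sum1_count big_mkcond /=.
rewrite (eq_bigr (fun i : 'I_(index v s) => (delta p s i.+1 : nat))); last first.
  by move=> i _; rewrite nth_nil addn0.
rewrite -(big_mkord xpredT (fun i => delta p s i.+1 : nat)).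
rewrite [RHS](_ : _ = \sum_(1 <= i < (index v s).+1) delta p s i); last first.
  by rewrite big_add1.
rewrite /index_iota subSS subn0.
rewrite big_seq_cond [RHS]big_seq_cond; apply: eq_bigr => i.
by rewrite andbT mem_iota => /andP[_ ->]; case: (delta _ _ _).
Qed.

(** [Z] matters only through the permutation sorting it, which by [Zmap_compat] is the previous one
    in the list. *)
Lemma comajs_pairmap Z p L : is_perm n p -> compat R (nthS Z) p ->
  all (is_perm n) L -> comajs R n Z L = pairmap (comaj n) p L.
Proof.
elim: L Z p => [|s L IHL] Z p pp Zp //= /andP[ps pL].
by rewrite (ComajRS_comaj pp ps Zp) (IHL _ s) //; apply: Zmap_compat Zp.
Qed.

(** The recursion starts from empty rows, hence from [tau], and runs through [rev L] up to the
    identity; the outer [rev] of [Qmono] restores the order. The default [tau] supplies the infinite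
    tail, where the exponents vanish. *)
Lemma nth_Qmono L j : validL R n L ->
  let s := nth (tau R n) (iota 1 n :: L) in
  nth 0 (Qmono R n L) j = comaj n (s j.+1) (s j).
Proof.
case/andP=> pL _; rewrite /= /Qmono /comaj_vec (@comajs_pairmap _ (tau R n)).
- set c := pairmap _ _ _; have sc: size c = (size L).+1.
    by rewrite size_pairmap size_rcons size_rev.
  case: (ltnP j (size L).+1) => jL; last first.
    rewrite nth_default ?size_rev ?sc // !nth_default /=; try lia.
    by apply/esym/eqP; rewrite comaj_eq0 ?tau_perm.
  rewrite nth_rev ?sc // /c (nth_pairmap (tau R n)); last first.
    by rewrite size_rcons size_rev ltn_subrL.
  rewrite -[rcons (rev L) _]rev_cons -rev_rcons.
  rewrite !nth_rev /= ?size_rcons ?subSS ?ltnS ?leq_subr //.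
    rewrite subKn // subSn ?leq_subr // subKn //= nth_rcons.
    case: ltnP => // jL'; rewrite [in RHS]nth_default //.
    by case: eqP.
  exact: leq_trans (leq_subr _ _) (leqnSn _).
- exact: tau_perm.
- by rewrite (eq_in_compat R (in1W nthS_nseq)) tau_compat.
- by rewrite all_rcons is_perm_id all_rev.
Qed.

End Comaj.

(** * Decoding permutations and partitions into lists of monomials *)

Lemma compat_trim R S K p : (forall v, size (S v) = K) ->
  compat R (fun v => trim (S v)) p = compat R S p.
Proof.
move=> SK; apply: eq_sorted => a b.
by rewrite /gtS lex_lt_trim ?eq_trim ?SK.
Qed.

(** Radix sort from the last column: [tau] sorts the empty rows, and each stable sort by one more
    column on the left preserves [compat]. *)
Lemma chain_compat R n K (s : nat -> seq nat) (c : nat -> nat -> nat) :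
  s K = tau R n -> (forall j, is_perm n (s j)) ->
  (forall j, j < K -> sorted (ordr (c j) (s j.+1)) (s j)) ->
  compat R (fun v => mkseq (c^~ v) K) (s 0).
Proof.
move=> sK ps ss.
suff: forall k, k <= K -> compat R (fun v => map (c^~ v) (iota (K - k) k)) (s (K - k)).
  by move/(_ K (leqnn K)); rewrite subnn.
elim=> [_|k IHk k_K]; first by rewrite subn0 sK; apply: tau_compat.
have Dk: K - k = (K - k.+1).+1 by lia.
have {}IHk := IHk (ltnW k_K); rewrite Dk in IHk; rewrite /=.
apply: (compat_cons IHk); last by apply: ss; lia.
by move=> v; rewrite !(is_perm_mem (ps _)).
Qed.

Section Decode.
Variables (R : pred nat) (n : nat).
Hypothesis n_gt0 : 0 < n.
Implicit Types (L J : seq (seq nat)).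

Definition permL L j := nth (tau R n) (iota 1 n :: L) j.
Definition rowJ J j := nth (nseq n 0) J j.
Definition colLJ L J j v := column n (permL L j.+1) (permL L j) (rowJ J j) v.
Definition decode K L J :=
  [seq trim (mkseq (fun j => colLJ L J j v) K) | v <- iota 1 n].

Lemma permL_perm L j : validL R n L -> is_perm n (permL L j).
Proof.
case/andP=> pL _; rewrite /permL.
have: all (is_perm n) (iota 1 n :: L) by rewrite /= is_perm_id.
case: (ltnP j (size (iota 1 n :: L))) => jL; last by rewrite nth_default ?tau_perm.
by move=> /all_nthP-/(_ (tau R n) j jL).
Qed.

Lemma rowJ_size J j : validJ n J -> size (rowJ J j) = n.
Proof.
case/andP=> /all_nthP rJ _; rewrite /rowJ.
case: (ltnP j (size J)) => jJ; last by rewrite nth_default ?size_nseq.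
exact/eqP/rJ.
Qed.

Lemma nth_Jmono J j :
  nth 0 (Jmono n J) j = \sum_(k < n) k.+1 * nth 0 (rowJ J j) k.
Proof.
rewrite /rowJ; case: (ltnP j (size J)) => jJ; first by rewrite (nth_map (nseq n 0)).
rewrite !nth_default ?size_map // big1 // => k _.
by rewrite nth_nseq if_same muln0.
Qed.

Lemma sum_colLJ L J j : validL R n L ->
  \sum_(v <- iota 1 n) colLJ L J j v = nth 0 (madd (Qmono R n L) (Jmono n J)) j.
Proof.
move=> vL; rewrite nth_madd nth_Qmono // nth_Jmono -sum_column //.
exact: permL_perm.
Qed.

Lemma nthS_decode K L J : {in iota 1 n,
  nthS (decode K L J) =1 fun v => trim (mkseq (fun j => colLJ L J j v) K)}.
Proof.
move=> v; rewrite mem_iota => v_n; rewrite /nthS (nth_map 0) ?size_iota; last lia.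
by rewrite nth_iota; last lia; rewrite (_ : 1 + v.-1 = v) //; lia.
Qed.

Lemma nth_sum_decode K L J j : validL R n L ->
  nth 0 (foldr madd [::] (decode K L J)) j =
  if j < K then nth 0 (madd (Qmono R n L) (Jmono n J)) j else 0.
Proof.
move=> vL; rewrite nth_foldr_madd big_map -sum_colLJ //; case: ltnP => jK.
  by apply: eq_bigr => v _; rewrite nth_trim nth_mkseq.
by rewrite big1 // => v _; rewrite nth_trim nth_default ?size_mkseq.
Qed.

(** The last permutation of [L] differs from [tau] and is followed by [tau], so its exponent is
    nonzero by [comaj_eq0]; the last row of [J] is nonzero as well. Beyond [size beta] both
    exponents must vanish. *)
Lemma size_bounds L J beta : validL R n L -> validJ n J ->
  meq (madd (Qmono R n L) (Jmono n J)) beta ->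
  size L <= size beta /\ size J <= size beta.
Proof.
move=> vL vJ /meqP QJ.
have QJ0 j : size beta <= j -> nth 0 (Qmono R n L) j = 0 /\ nth 0 (Jmono n J) j = 0.
  by move=> jb; have := QJ j; rewrite nth_madd [RHS]nth_default //; lia.
split; rewrite leqNgt; apply/negP => b_lt.
  case: L vL b_lt {QJ} QJ0 => // s L vL b_lt /(_ (size L).+1); rewrite /= in b_lt.
  case=> [|/eqP]; first lia.
  rewrite nth_Qmono // comaj_eq0 //; try exact: (permL_perm _ vL).
  rewrite [nth _ _ (size L).+2]nth_default // => /eqP e _.
  case/andP: (vL) => _; rewrite is_tauE // -nth_last -{}e => /eqP[].
  exact: set_nth_default.
case: J vJ b_lt {QJ} QJ0 => // r J vJ b_lt /(_ (size J)); rewrite /= in b_lt.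
case=> [|_ /eqP]; first lia.
rewrite nth_Jmono sum_nat_eq0 => /forallP r0.
case/andP: (vJ) => _ /hasP[x]; rewrite -nth_last => /(nthP 0)[k].
have sr: size (nth [::] (r :: J) (size J)) = n.
  by rewrite (set_nth_default (nseq n 0)) // (rowJ_size _ vJ).
rewrite [size (r :: J)]/= sr => kn <-; have /= := r0 (Ordinal kn).
by rewrite muln_eq0 /= /rowJ (set_nth_default [::]) // => ->.
Qed.

Lemma decode_inj beta L J L' J' :
  validL R n L -> validJ n J -> meq (madd (Qmono R n L) (Jmono n J)) beta ->
  validL R n L' -> validJ n J' -> meq (madd (Qmono R n L') (Jmono n J')) beta ->
  decode (size beta).+1 L J = decode (size beta).+1 L' J' -> L = L' /\ J = J'.
Proof.
move=> vL vJ QJ vL' vJ' QJ' eW.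
have [szL szJ] := size_bounds vL vJ QJ; have [szL' szJ'] := size_bounds vL' vJ' QJ'.
(* Trimming loses no exponent, so equal rows give equal columns. *)
have ec j : j < (size beta).+1 -> {in iota 1 n, colLJ L J j =1 colLJ L' J' j}.
  move=> jK v v_n; have := nthS_decode (size beta).+1 L J v_n.
  rewrite eW nthS_decode // => /(congr1 (nth 0 ^~ j)).
  by rewrite !nth_trim !nth_mkseq.
have ps j := permL_perm j vL; have ps' j := permL_perm j vL'.
have pL_big l j : size l <= size beta -> size beta < j -> permL l j = tau R n.
  by move=> sl bj; rewrite /permL nth_default //=; lia.
have eL j : permL L j = permL L' j.
  case: (ltnP j (size beta).+1) => jb; last by rewrite !pL_big.
  (* Downward induction from [tau]: once the permutations at [j.+1] agree, those at [j] are stable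
     sorts of the same column over the same order. *)
  have [k] := ubnP ((size beta).+1 - j); elim: k j jb => // k IHk j jb lt_k.
  have es: permL L j.+1 = permL L' j.+1.
    case: (ltnP j.+1 (size beta).+1) => jb'; last by rewrite !pL_big.
    by apply: IHk; lia.
  apply: (@ordr_inj n (colLJ L J j) (permL L j.+1)) => //; first exact: column_sorted.
  rewrite (@eq_in_sorted _ (mem (permL L' j)) _ (ordr (colLJ L' J' j) (permL L j.+1))).
  - by rewrite es; apply: column_sorted.
  - by move=> a b; rewrite !(is_perm_mem (ps' _)) // => a_n b_n; rewrite /ordr !ec.
  - by apply/allP.
split.
  case/andP: (vL) => _ nL; case/andP: (vL') => _ nL'.
  apply: (@finsupp_eq _ (tau R n)) => [||j]; last exact: eL j.+1.
    by case: (L) nL => // s l; rewrite is_tauE.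
  by case: (L') nL' => // s l; rewrite is_tauE.
case/andP: (vJ) => _ nJ; case/andP: (vJ') => _ nJ'.
have nz r l : has (fun x => x != 0) (last [::] (r :: l)) ->
    last (nseq n 0) (r :: l) != nseq n 0.
  by apply: contraTneq => /= ->; rewrite has_nseq andbF.
apply: (@finsupp_eq _ (nseq n 0)) => [||j].
- by case: (J) nJ => // r l /nz.
- by case: (J') nJ' => // r l /nz.
case: (ltnP j (size beta).+1) => jb; last first.
  by rewrite !nth_default // ?(leq_trans szJ) ?(leq_trans szJ') // ltnW.
have := ec j jb; rewrite /colLJ !eL; apply: column_inj; rewrite ?rowJ_size //.
Qed.

Lemma decode_compat beta L J :
  validL R n L -> validJ n J -> meq (madd (Qmono R n L) (Jmono n J)) beta ->
  compat R (nthS (decode (size beta).+1 L J)) (iota 1 n).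
Proof.
move=> vL vJ QJ; have [szL szJ] := size_bounds vL vJ QJ.
rewrite (eq_in_compat _ (nthS_decode _ _ _)) (@compat_trim _ _ (size beta).+1).
  (* [iota 1 n :: L] has at most [(size beta).+1] entries, so at this index the permutation is
     already [tau]; this fixes the number of columns. *)
  apply: (chain_compat (s := permL L)); rewrite ?/permL ?nth_default //.
    by move=> j; apply: permL_perm.
  by move=> j _; apply: column_sorted; apply: permL_perm.
by move=> v; rewrite size_mkseq.
Qed.

Lemma decode_surj beta W :
  size W = n -> all canon W -> compat R (nthS W) (iota 1 n) ->
  meq (foldr madd [::] W) beta ->
  exists L J, [/\ validL R n L, validJ n J,
    meq (madd (Qmono R n L) (Jmono n J)) beta & decode (size beta).+1 L J = W].
Proof.
move=> sW cW compW /meqP wW.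
set K := (size beta).+1; pose c j v := nth 0 (nthS W v) j.
have sum_c j : \sum_(v <- iota 1 n) c j v = nth 0 beta j.
  rewrite -wW nth_foldr_madd (big_nth [::]) sW big_mkord.
  by rewrite (iotaDl 1 0) big_map -[iota 0 n]val_enum_ord big_map big_enum.
have c0 j : K <= j -> {in iota 1 n, c j =1 fun=> 0}.
  move=> Kj v v_n; have /eqP := sum_c j; rewrite [nth _ _ _]nth_default; last exact: ltnW.
  by rewrite sum_nat_seq_eq0 => /allP/(_ v v_n)/eqP.
(* Each permutation is built from the one after it, so [sgs] counts down from column [K], where
   [tau] starts the recursion. *)
pose fix sgs k : seq nat := if k is k'.+1
  then strict_sort (ordr (c (K - k)) (sgs k')) (iota 1 n) else tau R n.
pose s j := sgs (K - j).
have ps j : is_perm n (s j).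
  by rewrite /s; case: (K - j) => [|k]; apply: strict_sort_perm.
have sK j : K <= j -> s j = tau R n by rewrite /s -subn_eq0 => /eqP->.
have ss j : sorted (ordr (c j) (s j.+1)) (s j).
  case: (ltnP j K) => jK; last first.
    rewrite !sK //; last exact: leqW.
    apply: (ordr_refl (tau_perm _ _)) => a b.
    rewrite !(is_perm_mem (tau_perm _ _)) => a_n b_n.
    by rewrite !c0.
  have ->: s j = strict_sort (ordr (c j) (s j.+1)) (iota 1 n).
    rewrite /s (_ : K - j = (K - j.+1).+1); last lia.
    by rewrite [sgs _.+1]/= (_ : K - (K - j.+1).+1 = j) //; lia.
  by apply: ordr_sort.
(* Both [s 0] and the identity sort the rows of [W], and the sorting permutation is unique. *)
have s0: s 0 = iota 1 n.
  have comp0: compat R (fun v => mkseq (c^~ v) K) (s 0).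
    by apply: (chain_compat (n := n)) => //; apply: sK.
  apply: (compat_inj comp0); last exact: is_perm_mem.
  rewrite -(@compat_trim _ _ K) => [|v]; last by rewrite size_mkseq.
  rewrite (@eq_in_compat _ _ (nthS W)) // => v v_n.
  have cWv: canon (nthS W v).
    move: v_n; rewrite mem_iota => v_n.
    by move: cW => /all_nthP; apply; lia.
  rewrite -[RHS](eqP cWv); apply: trim_ext => j.
  case: (ltnP j K) => jK; first by rewrite nth_mkseq.
  by rewrite [LHS]nth_default ?size_mkseq // -[RHS]/(c j v) c0.
pose r j := increments n (c j) (s j.+1) (s j).
have cr j : {in iota 1 n, column n (s j.+1) (s j) (r j) =1 c j}.
  exact: column_increments.
have [L nL eL] : exists2 L : seq (seq nat), (L == [::]) || (last (tau R n) L != tau R n) &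
    nth (tau R n) L =1 fun j => s j.+1.
  by apply: (@finsupp_exists _ _ K) => j jK; apply: sK; apply: leqW.
have [J nJ eJ] : exists2 J : seq (seq nat),
    (J == [::]) || (last (nseq n 0) J != nseq n 0) &
    nth (nseq n 0) J =1 r.
  apply: (@finsupp_exists _ _ K) => j jK.
  (* From [K] on both permutations are [tau] and the column is zero, as is the column of the zero
     row, so the increments vanish. *)
  apply: (@column_inj n (s j.+1) _ _ _ (ps j)); rewrite ?size_mkseq ?size_nseq //.
  move=> v v_n; rewrite [LHS](cr j v v_n) c0 // /column big1 // => i _.
  have i_n: i < n.
    apply: leq_trans (ltn_ord i) _.
    by rewrite -(is_perm_size (ps j)) index_mem (is_perm_mem (ps j)).
  rewrite nth_nseq if_same addn0; move: (i : nat) i_n => {}i i_n.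
  rewrite (sK _ jK) (sK _ (leqW jK)).
  have i_n' : i.-1 < n by lia.
  rewrite /delta !index_uniq ?(is_perm_uniq (tau_perm R n))
    ?(is_perm_size (tau_perm R n)) //.
  by apply/eqP; rewrite eqb0; lia.
have permLE j : permL L j = s j by case: j => [|j]; rewrite /permL ?s0 //= eL.
have vL : validL R n L.
  apply/andP; split; first by apply/(all_nthP (tau R n)) => j _; rewrite eL.
  by case: (L) nL => // x l; rewrite is_tauE.
have vJ : validJ n J.
  apply/andP; split; first by apply/(all_nthP (nseq n 0)) => j _; rewrite eJ size_mkseq.
  case: (J) nJ (eJ (size J).-1) => //= x l nx; rewrite nth_last /= => er.
  apply: contraR nx; rewrite -all_predC => a0; apply/eqP.
  rewrite -[n in RHS](size_mkseq _ n : size (r (size l)) = n) -er.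
  by apply/all_pred1P; apply: sub_all a0 => y; rewrite /= negbK.
have cE j : {in iota 1 n, colLJ L J j =1 c j}.
  by move=> v v_n; rewrite /colLJ !permLE /rowJ eJ; apply: cr.
exists L, J; split=> //.
  by apply/meqP => j; rewrite -sum_colLJ // -sum_c; apply: eq_big_seq => v /cE.
apply: (@eq_from_nth _ [::]); rewrite size_map size_iota ?sW // => v v_n.
have v_n': v.+1 \in iota 1 n by rewrite mem_iota.
rewrite [LHS](nthS_decode K L J v_n' : nth _ _ v = _).
have /(all_nthP [::]) := cW; rewrite sW => /(_ v v_n)/eqP <-; apply: trim_ext => j.
case: (ltnP j K) => jK; first by rewrite nth_mkseq // cE.
by rewrite nth_default ?size_mkseq // -[RHS]/(c j v.+1) c0.
Qed.

End Decode.

(** ** Standardization of semistandard tableaux *)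

Lemma map_uniq_inj (A B : eqType) (f : A -> B) (s : seq A) :
  uniq (map f s) -> {in s &, injective f}.
Proof.
elim: s => //= x s IHs /andP[fx us] a b; rewrite !inE.
case/orP=> [/eqP->|sa] /orP[/eqP->|sb] // eab; last exact: IHs us a b sa sb eab.
  by case/mapP: fx; exists b.
by case/mapP: fx; exists a.
Qed.

Lemma all_flatten (A : Type) (p : pred A) ss : all p (flatten ss) = all (all p) ss.
Proof. by elim: ss => //= s ss <-; rewrite all_cat. Qed.

(** * Tableaux as functions on cells *)

Definition cells (lam : seq nat) : seq (nat * nat) :=
  [seq (i, j) | i <- iota 0 (size lam), j <- iota 0 (nth 0 lam i)].

(** Up to [tab_ent] every tableau of shape [lam] has this form, which turns row and column
    conditions into conditions on neighbouring cells. *)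
Definition tab (T : Type) (lam : seq nat) (f : nat * nat -> T) : seq (seq T) :=
  [seq [seq f (i, j) | j <- iota 0 (nth 0 lam i)] | i <- iota 0 (size lam)].

Definition ent (T : Type) (x0 : T) (t : seq (seq T)) (c : nat * nat) : T :=
  entry x0 t c.1 c.2.

Lemma mem_cells lam i j : ((i, j) \in cells lam) = (j < nth 0 lam i).
Proof.
apply/allpairsPdep/idP => [[i' [j' []]]|j_lt].
  by rewrite !mem_iota => _ /andP[_ j_lt] [-> ->].
exists i, j; rewrite !mem_iota; split=> //=.
by case: ltnP => // i_ge; rewrite nth_default in j_lt.
Qed.

Lemma cells_uniq lam : uniq (cells lam).
Proof.
apply: allpairs_uniq_dep => [|i _|[i j] [i' j'] _ _ /= [-> ->] //]; exact: iota_uniq.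
Qed.

Lemma partition_dec lam i : sorted geq lam -> nth 0 lam i.+1 <= nth 0 lam i.
Proof.
move=> lam_dec; case: (ltnP i.+1 (size lam)) => i_lt; last by rewrite nth_default.
exact: (sortedP 0 lam_dec).
Qed.

Section Tab.
Variables (T : Type) (x0 : T) (lam : seq nat).
Implicit Types (f : nat * nat -> T) (t : seq (seq T)).

Lemma size_tab f : map size (tab lam f) = lam.
Proof.
rewrite -map_comp -[RHS](mkseq_nth 0); apply: eq_map => i /=.
by rewrite size_map size_iota.
Qed.

Lemma nth_tab f i : nth [::] (tab lam f) i = [seq f (i, j) | j <- iota 0 (nth 0 lam i)].
Proof.
case: (ltnP i (size lam)) => i_lt; first by rewrite (nth_mkseq [::]).
by rewrite !nth_default ?size_map ?size_iota.
Qed.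

Lemma ent_tab f c : c \in cells lam -> ent x0 (tab lam f) c = f c.
Proof.
by case: c => i j; rewrite mem_cells /ent /entry nth_tab => /(nth_mkseq x0)->.
Qed.

Lemma tab_ent t : map size t = lam -> t = tab lam (ent x0 t).
Proof.
move=> st; have st' i : size (nth [::] t i) = nth 0 lam i.
  by rewrite -st; elim: (t) i => [|r t' IHt] [|i] //=.
apply: (@eq_from_nth _ [::]); first by rewrite size_map size_iota -st size_map.
move=> i _; rewrite nth_tab; apply: (@eq_from_nth _ x0).
  by rewrite size_map size_iota st'.
by move=> j j_lt; rewrite nth_mkseq // -st'.
Qed.

Lemma flatten_tab f : flatten (tab lam f) = map f (cells lam).
Proof.
by rewrite map_flatten -map_comp; congr flatten; apply: eq_map => i /=; rewrite -map_comp.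
Qed.

Lemma rows_tabP f (e : rel T) :
  reflect (forall i j, (i, j.+1) \in cells lam -> e (f (i, j)) (f (i, j.+1)))
    (all (sorted e) (tab lam f)).
Proof.
apply: (iffP idP) => [/(all_nthP [::]) se i j|se]; last first.
  apply/(all_nthP [::]) => i _; rewrite nth_tab.
  apply/(sortedP x0) => j; rewrite size_map size_iota => j_lt.
  by rewrite !(nth_mkseq x0) //; [apply: se; rewrite mem_cells | apply: ltnW].
rewrite mem_cells => j_lt; have i_lt: i < size (tab lam f).
  rewrite size_map size_iota; by case: ltnP => // i_ge; rewrite nth_default in j_lt.
have := se i i_lt; rewrite nth_tab => /(sortedP x0)/(_ j).
by rewrite size_map size_iota !(nth_mkseq x0) //; [apply | apply: ltnW].
Qed.

Lemma cols_tabP f (e : rel T) : sorted geq lam ->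
  reflect (forall i j, (i.+1, j) \in cells lam -> e (f (i, j)) (f (i.+1, j)))
    (cols_strict x0 e (tab lam f)).
Proof.
move=> lam_dec; have entE i j : j < nth 0 lam i -> entry x0 (tab lam f) i j = f (i, j).
  by move=> j_lt; apply: (@ent_tab f (i, j)); rewrite mem_cells.
rewrite /cols_strict size_map size_iota; apply: (iffP allP) => [ce i j|ce i i_lt].
  rewrite mem_cells => j_lt; have i_lt: i.+1 < size lam.
    by case: ltnP => // i_ge; rewrite nth_default in j_lt.
  have /ce/allP/(_ j) : i \in iota 0 (size lam).-1 by rewrite mem_iota; lia.
  rewrite nth_tab size_map size_iota mem_iota !entE //; first exact.
  exact: leq_trans j_lt (partition_dec i lam_dec).
apply/allP=> j; rewrite nth_tab size_map size_iota mem_iota => /andP[_ j_lt].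
rewrite !entE //; first by apply: ce; rewrite mem_cells.
exact: leq_trans j_lt (partition_dec i lam_dec).
Qed.

End Tab.

(** * The order on cells behind standardization *)

Lemma lex_le_trans : transitive (fun a b => ~~ lex_lt b a).
Proof.
move=> b a c /= ab bc; apply/negP => ca.
case: (eqVneq b c) => [e|/lex_lt_total]; first by rewrite e ca in ab.
by rewrite (negPf bc) orbF => /lex_lt_trans/(_ ca); rewrite (negPf ab).
Qed.

Lemma lex_le_anti : antisymmetric (fun a b => ~~ lex_lt b a).
Proof.
move=> a b /andP[ab ba]; apply/eqP/contraT => /lex_lt_total.
by rewrite (negPf ab) (negPf ba).
Qed.

Lemma lex_leVlt a b : ~~ lex_lt b a = lex_lt a b || (a == b).
Proof.
case: (eqVneq a b) => [->|/lex_lt_total]; first by rewrite lex_lt_irr orbT.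
case lab: (lex_lt a b) => /=; last by move=> ->.
move=> _; apply/negP => lba; by have := lex_lt_trans lab lba; rewrite lex_lt_irr.
Qed.

(* Equal entries of a semistandard tableau form a horizontal strip, which
   standardization labels from left to right, that is, from the lower rows up. *)
Definition cell_lt (w : nat * nat -> seq nat) (c d : nat * nat) : bool :=
  lex_lt (w c) (w d) ||
  ((w c == w d) && ((d.1 < c.1) || ((c.1 == d.1) && (c.2 < d.2)))).

Lemma cell_lt_irr w : irreflexive (cell_lt w).
Proof. by move=> c; rewrite /cell_lt lex_lt_irr !ltnn !andbF. Qed.

Lemma cell_lt_trans w : transitive (cell_lt w).
Proof.
move=> d c e; rewrite /cell_lt; case/orP=> [cd|/andP[/eqP-> rcd]].
  case/orP=> [de|/andP[/eqP<- _]]; first by rewrite (lex_lt_trans cd de).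
  by rewrite cd.
by case/orP=> [->//|/andP[-> rde]]; apply/orP; right => /=; move: rcd rde; lia.
Qed.

Lemma cell_lt_total w c d : c != d -> cell_lt w c d || cell_lt w d c.
Proof.
case: c d => [i j] [i' j']; rewrite xpair_eqE /cell_lt /=.
case: (eqVneq (w (i, j)) (w (i', j'))) => [->|/lex_lt_total].
  by rewrite lex_lt_irr; lia.
by case/orP=> ->; rewrite ?orbT.
Qed.

Lemma eq_in_tab (T : Type) lam (f g : nat * nat -> T) :
  {in cells lam, f =1 g} -> tab lam f = tab lam g.
Proof.
move=> efg; apply: eq_map => i; apply/eq_in_map => j; rewrite mem_iota => /andP[_ j_lt].
by apply: efg; rewrite mem_cells.
Qed.

Lemma rowof_tab lam (f : nat * nat -> nat) c :
  {in cells lam &, injective f} -> c \in cells lam -> rowof (tab lam f) (f c) = c.1.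
Proof.
move=> f_inj lam_c.
have in_row i : f c \in nth [::] (tab lam f) i -> i = c.1.
  rewrite nth_tab => /mapP[j]; rewrite mem_iota => /andP[_ j_lt].
  by move/f_inj => ->; rewrite ?mem_cells.
have c_row : f c \in nth [::] (tab lam f) c.1.
  case: c lam_c {in_row} => i j lam_ij; rewrite nth_tab; apply: map_f.
  by rewrite mem_iota -mem_cells.
have size_t: c.1 < size (tab lam f).
  by case: ltnP => // c_ge; rewrite nth_default in c_row.
rewrite /rowof; case: findP => [/(has_nthP [::])[]|i i_lt ri _].
  by exists c.1.
by apply: in_row; apply: ri.
Qed.

(** * Standard tableaux with compatible lists of monomials *)

Section Standardize.
Variables (n : nat) (lam : seq nat).
Hypothesis lam_part : is_partition n lam.

Let lam_dec : sorted geq lam. Proof. by case/and3P: lam_part. Qed.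

Lemma size_cells : size (cells lam) = n.
Proof.
case/and3P: lam_part => _ _ /eqP <-; rewrite size_allpairs_dep.
congr sumn; rewrite -[RHS](mkseq_nth 0); apply: eq_map => i /=.
by rewrite size_iota.
Qed.

(** The inverse of standardization, chosen as the map because it is a plain substitution of
    monomials for labels. *)
Definition destandardize (x : seq (seq nat) * seq (seq nat)) : seq (seq (seq nat)) :=
  map (map (nthS x.2)) x.1.

Section Mid.
Variables (T W : seq (seq nat)).
Hypotheses (T_syt : syt n lam T) (sW : size W = n).
Hypothesis W_compat : compat (des n T) (nthS W) (iota 1 n).
Local Notation f := (ent 0 T).
Local Notation S := (nthS W).

Lemma syt_tab : T = tab lam f.
Proof. by case/and4P: T_syt => /eqP /(tab_ent 0). Qed.

Lemma syt_perm : perm_eq (map f (cells lam)) (iota 1 n).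
Proof. by rewrite -flatten_tab -syt_tab; case/and4P: T_syt. Qed.

Lemma syt_inj : {in cells lam &, injective f}.
Proof. by apply: map_uniq_inj; rewrite (perm_uniq syt_perm) iota_uniq. Qed.

Lemma syt_range c : c \in cells lam -> 0 < f c <= n.
Proof. by move=> /(map_f f); rewrite (perm_mem syt_perm) mem_iota add1n ltnS. Qed.

Lemma syt_rowof c : c \in cells lam -> rowof T (f c) = c.1.
Proof. by rewrite {1}syt_tab; apply: rowof_tab syt_inj. Qed.

Lemma syt_row i j k : (i, k) \in cells lam -> j < k -> f (i, j) < f (i, k).
Proof.
rewrite mem_cells => k_lt j_lt; case/and4P: T_syt => _ _ + _.
rewrite {1}syt_tab => /(all_nthP [::])/(_ i); rewrite nth_tab size_map size_iota.
have i_lt: i < size lam by case: ltnP => // i_ge; rewrite nth_default in k_lt.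
move/(_ i_lt)/(sorted_ltn_nth ltn_trans 0)/(_ j k).
have j_lt' := ltn_trans j_lt k_lt.
by rewrite !inE size_map size_iota !(nth_mkseq 0) //; apply.
Qed.

Lemma mid_le a b : 0 < a <= b -> b <= n -> lex_lt (S a) (S b) || (S a == S b).
Proof.
case/andP=> a0; rewrite leq_eqVlt => /orP[/eqP->|ab] bn; first by rewrite eqxx orbT.
have b0 : 0 < b := leq_ltn_trans (leq0n a) ab.
have [a1 b1 ab1] : [/\ a.-1 < n, b.-1 < n & a.-1 < b.-1].
  by clear -a0 b0 ab bn; split; lia.
have := sorted_ltn_nth (@ltS_trans _ _) 0 W_compat a.-1 b.-1.
rewrite !inE size_iota !nth_iota // => /(_ a1 b1 ab1); rewrite !add1n !prednK //.
by case/orP=> [->//|/andP[/eqP-> _]]; rewrite eqxx orbT.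
Qed.

(** [W] is weakly increasing, hence constant from [a] to [b]. Where neighbours are equal, [compat]
    reduces to [tie] and excludes a descent of [T], so no step goes to a lower row. *)
Lemma mid_eq_row a b : 0 < a <= b -> b <= n -> S a = S b -> rowof T b <= rowof T a.
Proof.
elim: b => [|b IHb] /andP[a0]; first by case: a a0.
rewrite leq_eqVlt => /orP[/eqP->//|ab] bn eab.
have b_range: 0 < b < n by rewrite bn (leq_trans a0).
have b0 : 0 < b by case/andP: b_range.
have eb: S a = S b.
  have leab: 0 < a <= b by rewrite a0.
  have leb: 0 < b <= b.+1 by rewrite b0 /=.
  case/orP: (mid_le leab (ltnW bn)) => [ltab|/eqP//].
  case/orP: (mid_le leb bn) => [ltb|/eqP eb]; last by rewrite eab.
  by have := lex_lt_trans ltab ltb; rewrite eab lex_lt_irr.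
apply: leq_trans (IHb _ (ltnW bn) eb); last by rewrite a0.
have /(sortedP 0)/(_ b.-1) := W_compat.
rewrite size_iota prednK // => /(_ bn).
rewrite nth_iota // nth_iota ?(leq_ltn_trans (leq_pred b)) // !add1n prednK //.
rewrite /gtS -eb eab lex_lt_irr eqxx /tie /=.
rewrite ltnSn /= ltnNge leqnSn /= orbF /simR.
rewrite (minn_idPl _) // (maxn_idPr _) // subSnn /= andbT.
by rewrite /des b_range /= -leqNgt.
Qed.

(** For equal monomials the larger label is never in a lower row, and within one row it is further
    right. *)
Lemma mid_cell_lt c d : c \in cells lam -> d \in cells lam -> f c < f d ->
  cell_lt (S \o f) c d.
Proof.
move=> lam_c lam_d lt_cd; have rc := syt_range lam_c; have rd := syt_range lam_d.
rewrite /cell_lt /=; have fd_n: f d <= n by case/andP: rd.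
have fcd: 0 < f c <= f d by case/andP: rc => -> _; apply: ltnW.
case/orP: (mid_le fcd fd_n) => [->//|/eqP ecd].
rewrite ecd eqxx lex_lt_irr /=.
have := mid_eq_row fcd fd_n ecd.
rewrite !syt_rowof //.
case: c d lam_c lam_d lt_cd {rc rd ecd fd_n fcd} => [i j] [i' j'].
move=> lam_c lam_d lt_cd /= le_row.
move: le_row; rewrite leq_eqVlt orbC => /orP[->//|/eqP ei].
rewrite {i'}ei ltnn eqxx /= in lam_d lt_cd *.
rewrite ltnNge leq_eqVlt; apply/negP=> /orP[/eqP ej|/(syt_row lam_c)].
  by rewrite ej ltnn in lt_cd.
by rewrite ltnNge ltnW.
Qed.

(** Both sides are strict total orders on the cells, so one implication gives the equivalence. *)
Lemma mid_cell_ltE c d : c \in cells lam -> d \in cells lam ->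
  (f c < f d) = cell_lt (S \o f) c d.
Proof.
move=> lam_c lam_d; apply/idP/idP; first exact: mid_cell_lt.
case: ltngtP => // [dc cd|/(syt_inj lam_c lam_d)->]; last by rewrite cell_lt_irr.
by have := cell_lt_trans (mid_cell_lt lam_d lam_c dc) cd; rewrite cell_lt_irr.
Qed.

Lemma destandardizeE : destandardize (T, W) = tab lam (S \o f).
Proof.
rewrite /destandardize /= {1}syt_tab /tab -map_comp; apply: eq_map => i /=.
by rewrite -map_comp.
Qed.

Lemma mid_W : W = map S (iota 1 n).
Proof.
apply: (@eq_from_nth _ [::]) => [|i]; rewrite ?size_map ?size_iota // sW => i_n.
by rewrite (nth_map 0) ?size_iota ?nth_iota // /nthS add1n.
Qed.

Lemma destandardize_perm : perm_eq (flatten (destandardize (T, W))) W.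
Proof.
rewrite destandardizeE flatten_tab map_comp.
by rewrite [X in perm_eq _ X]mid_W; apply/perm_map/syt_perm.
Qed.

Lemma mid_sorted : sorted (fun a b => ~~ lex_lt b a) W.
Proof.
rewrite mid_W; apply: homo_sorted W_compat => a b.
by rewrite /gtS eq_sym lex_leVlt => /orP[->//|/andP[->]]; rewrite orbT.
Qed.

Lemma destandardize_ssyt : all canon W -> ssyt_mono lam (destandardize (T, W)).
Proof.
move=> cW; apply/and4P; split.
- by rewrite destandardizeE size_tab.
- have: all canon (flatten (destandardize (T, W))).
    by rewrite (perm_all _ destandardize_perm).
  by rewrite all_flatten.
- rewrite destandardizeE; apply/(rows_tabP [::]) => i j lam_ij.
  have lam_ij' : (i, j) \in cells lam by move: lam_ij; rewrite !mem_cells; apply: ltnW.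
  have := mid_cell_lt lam_ij' lam_ij (syt_row lam_ij (ltnSn j)).
  by rewrite lex_leVlt => /orP[->//|/andP[-> _]]; rewrite orbT.
rewrite destandardizeE; apply/(cols_tabP [::]) => // i j lam_ij.
have lam_ij' : (i, j) \in cells lam.
  move: lam_ij; rewrite !mem_cells => /leq_trans; apply.
  exact: partition_dec.
case/and4P: (T_syt) => _ _ _; rewrite {1}syt_tab.
move=> /(cols_tabP 0 _ _ lam_dec)/(_ i j lam_ij) lt_ij.
have := mid_cell_lt lam_ij' lam_ij lt_ij.
(* With equal entries [cell_lt] would put the lower cell first, so the comparison down a column is
   strict. *)
by rewrite /cell_lt /=; case/orP=> [//|]; lia.
Qed.

End Mid.

(** [W] is the sorted content of the tableau, and the label of a cell in [T] is its rank for
    [cell_lt], an order that depends only on the tableau. *)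
Lemma destandardize_inj T W T' W' : syt n lam T -> syt n lam T' ->
  size W = n -> size W' = n ->
  compat (des n T) (nthS W) (iota 1 n) -> compat (des n T') (nthS W') (iota 1 n) ->
  destandardize (T, W) = destandardize (T', W') -> (T, W) = (T', W').
Proof.
move=> sT sT' sW sW' cW cW' eTW.
have eW: W = W'.
  apply: (sorted_eq lex_le_trans lex_le_anti (mid_sorted sW cW) (mid_sorted sW' cW')).
  have := destandardize_perm sT' sW'; rewrite -eTW; apply: perm_trans.
  by rewrite perm_sym destandardize_perm.
congr (_, _) => //; rewrite (syt_tab sT) (syt_tab sT').
have rank T0 W0 c : syt n lam T0 -> size W0 = n ->
    compat (des n T0) (nthS W0) (iota 1 n) ->
    c \in cells lam ->
    ent 0 T0 c =
    (count (cell_lt (ent [::] (destandardize (T0, W0))) ^~ c) (cells lam)).+1.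
  move=> sT0 sW0 cW0 lam_c; have := syt_range sT0 lam_c; set v := ent 0 T0 c => v_n.
  transitivity (count (fun x => x < v) (iota 1 n)).+1.
    rewrite (_ : n = v.-1 + (n - v.-1)); last lia.
    rewrite iotaD count_cat (_ : count _ (iota 1 v.-1) = v.-1); last first.
      rewrite -[RHS](size_iota 1) -count_predT.
      by apply: eq_in_count => x; rewrite mem_iota /=; lia.
    rewrite (_ : count _ _ = 0); first lia.
    apply/eqP; rewrite -leqn0 leqNgt -has_count.
    by apply/hasPn => x; rewrite mem_iota; lia.
  congr _.+1; rewrite -(permP (syt_perm sT0)) count_map; apply: eq_in_count => d lam_d /=.
  by rewrite (mid_cell_ltE sT0 cW0) // /cell_lt destandardizeE // !ent_tab.
apply: eq_in_tab => c lam_c; rewrite (rank T W) // (rank T' W') //.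
by rewrite eTW.
Qed.

End Standardize.

(** Sorting the cells by [cell_lt] gives both parts: the position of a cell is its label in [T], and
    the entries read in this order form [W]. *)
Lemma destandardize_surj n lam t : is_partition n lam -> ssyt_mono lam t ->
  exists T W, [/\ syt n lam T, size W = n, all canon W,
    compat (des n T) (nthS W) (iota 1 n) & destandardize (T, W) = t].
Proof.
move=> lam_part; have lam_dec : sorted geq lam by case/and3P: lam_part.
case/and4P=> /eqP st cant rt ct; have Dt := tab_ent [::] st.
pose w := ent [::] t; rewrite -/w in Dt.
pose cs := strict_sort (cell_lt w) (cells lam).
have cs_perm : perm_eq cs (cells lam) by rewrite perm_sort.
have cs_uniq : uniq cs by rewrite (perm_uniq cs_perm) cells_uniq.
have cs_size : size cs = n by rewrite (perm_size cs_perm) (size_cells lam_part).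
have cs_sorted : sorted (cell_lt w) cs.
  apply: strict_sortP (cells_uniq lam); first exact: cell_lt_trans.
  by move=> c d _ _; apply: cell_lt_total.
pose f c := (index c cs).+1; pose T := tab lam f; pose W := map w cs.
have lt_f c d : c \in cells lam -> d \in cells lam -> cell_lt w c d -> f c < f d.
  rewrite -!(perm_mem cs_perm) => lam_c lam_d.
  by rewrite (sorted_index (@cell_lt_trans w) (@cell_lt_irr w) cs_sorted).
have f_inj : {in cells lam &, injective f}.
  move=> c d; rewrite -!(perm_mem cs_perm) => lam_c lam_d [].
  exact: (index_inj c lam_c lam_d).
have w_row i j : (i, j.+1) \in cells lam -> ~~ lex_lt (w (i, j.+1)) (w (i, j)).
  by move: rt; rewrite {1}Dt => /(rows_tabP [::])/(_ i j).
have w_col i j : (i.+1, j) \in cells lam -> lex_lt (w (i, j)) (w (i.+1, j)).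
  by move: ct; rewrite {1}Dt => /(cols_tabP [::] _ _ lam_dec)/(_ i j).
have tabW : destandardize (T, W) = t.
  rewrite Dt /destandardize /T /tab -map_comp; apply: eq_map => i /=.
  rewrite -map_comp; apply/eq_in_map => j; rewrite mem_iota => /andP[_ j_lt].
  have lam_ij: (i, j) \in cs by rewrite (perm_mem cs_perm) mem_cells.
  by rewrite /= /nthS /= (nth_map (i, j)) ?index_mem // nth_index.
exists T, W; split=> //; first 1 last.
- by rewrite size_map.
- have: all canon (flatten t) by rewrite all_flatten.
  by rewrite {1}Dt flatten_tab -(perm_all _ (perm_map w cs_perm)).
- apply/(sortedP 0) => i; rewrite size_iota => i_n.
  rewrite !nth_iota ?(ltnW i_n) // !add1n.
  have /(sortedP (0, 0))/(_ i) := cs_sorted; rewrite cs_size => /(_ i_n).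
  set c := nth _ cs i; set d := nth _ cs i.+1 => lt_cd.
  have cs_c : c \in cells lam by rewrite -(perm_mem cs_perm) mem_nth ?cs_size ?(ltnW i_n).
  have cs_d : d \in cells lam by rewrite -(perm_mem cs_perm) mem_nth ?cs_size.
  have fc: f c = i.+1 by rewrite /f index_uniq ?cs_size ?(ltnW i_n).
  have fd: f d = i.+2 by rewrite /f index_uniq ?cs_size.
  rewrite /gtS /nthS /= !(nth_map (0, 0)) ?cs_size ?(ltnW i_n) // -/c -/d.
  (* For equal neighbours [cell_lt] places the next cell in the same or a higher row, so [i.+1] is
     not a descent of [T]. *)
  case/orP: lt_cd => [->//|/andP[/eqP-> lt_cd]]; rewrite eqxx /tie ltnSn lex_lt_irr /=.
  rewrite ltnNge leqnSn /= orbF /simR (minn_idPl _) // (maxn_idPr _) // subSnn /= andbT.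
  rewrite /des /= i_n /= -fd -fc !rowof_tab // -leqNgt.
  by case/orP: lt_cd => [/ltnW|/andP[/eqP->]].
apply/and4P; split; first by rewrite size_tab.
- rewrite flatten_tab -(permPl (perm_map f cs_perm)) -cs_size.
  rewrite (_ : map f cs = iota 1 (size cs)) //.
  rewrite (iotaDl 1 0).
  apply: (@eq_from_nth _ 0); rewrite !size_map ?size_iota // => i i_n.
  by rewrite !(nth_map (0, 0)) // /f index_uniq // (nth_map 0) ?size_iota // nth_iota.
- apply/(rows_tabP 0) => i j lam_ij.
  have lam_ij' : (i, j) \in cells lam by move: lam_ij; rewrite !mem_cells; apply: ltnW.
  apply: lt_f => //; move: (w_row i j lam_ij); rewrite lex_leVlt /cell_lt.
  by case/orP=> ->; rewrite //= eqxx ltnSn !orbT.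
apply/(cols_tabP 0) => // i j lam_ij.
have lam_ij' : (i, j) \in cells lam.
  by move: lam_ij; rewrite !mem_cells => /leq_trans; apply; apply: partition_dec.
by apply: lt_f => //; rewrite /cell_lt w_col.
Qed.

(** * Finiteness and comparison of coefficients *)

Lemma size_trim s : size (trim s) <= size s.
Proof. by elim: s => //= x s IHs; case: ifP. Qed.

Lemma canon_size s k : canon s -> (forall j, k <= j -> nth 0 s j = 0) -> size s <= k.
Proof.
move=> /eqP <- s0; rewrite (@trim_ext _ (mkseq (nth 0 s) k)).
  by rewrite (leq_trans (size_trim _)) ?size_mkseq.
move=> j; case: (ltnP j k) => jk; first by rewrite nth_mkseq.
by rewrite [RHS]nth_default ?size_mkseq // -nth_trim s0.
Qed.

Lemma leq_sumn x s : x \in s -> x <= sumn s.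
Proof. by elim: s => //= y s IHs; rewrite inE => /orP[/eqP->|/IHs]; lia. Qed.

(** The exponents of each entry are bounded by those of [beta], and canonical entries have no
    trailing zeros, so all tableaux lie in an explicit finite list of words. *)
Lemma lhs_finite lam beta : exists c, has_card (lhs_pred lam beta) c.
Proof.
apply: (@has_card_sub _ _ (words (words (words (iota 0 (sumn beta).+1) (size beta))
  (sumn lam)) (size lam))) => t /andP[/and4P[/eqP st cant _ _] /meqP wt].
apply: mem_words => [|r tr]; first by rewrite -st size_map.
apply: mem_words => [|s rs].
  by apply: leq_sumn; rewrite -st; apply: map_f.
have cs: canon s by move/allP/(_ r tr)/allP/(_ s rs): cant.
have s_le j : nth 0 s j <= nth 0 beta j.
  rewrite -wt nth_foldr_madd (big_rem s) ?leq_addr //.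
  by apply/flattenP; exists r.
apply: mem_words => [|x /(nthP 0)[j _ <-]].
  apply: canon_size => // j jb; apply/eqP.
  by rewrite -leqn0; apply: leq_trans (s_le j) _; rewrite nth_default.
rewrite mem_iota /= add0n ltnS; apply: leq_trans (s_le j) _.
case: (ltnP j (size beta)) => jb; last by rewrite nth_default.
by apply/leq_sumn/mem_nth.
Qed.

(** The intermediate set, in bijection with both sides: by [destandardize] with the tableaux, by
    [decode] with the triples. *)
Definition mid_pred (n : nat) (lam beta : seq nat)
    (x : seq (seq nat) * seq (seq nat)) : bool :=
  let: (T, W) := x in
  [&& syt n lam T, size W == n, all canon W,
      compat (des n T) (nthS W) (iota 1 n) & meq (foldr madd [::] W) beta].

(* Equality of formal power series in q_1, q_2, ..., coefficientwise:
   for every monomial q^beta, the coefficient sets on both sides are finite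
   and have the same cardinality. *)
Theorem theorem3 (n : nat) (lam : seq nat) :
  0 < n -> is_partition n lam ->
  forall beta : seq nat,
    exists c : nat, has_card (lhs_pred lam beta) c /\ has_card (rhs_pred n lam beta) c.
Proof.
move=> n_gt0 lam_part beta; have [c lhs_c] := lhs_finite lam beta.
exists c; split=> //.
have weightE T W : syt n lam T -> size W = n ->
    meq (ssyt_weight (destandardize (T, W))) beta = meq (foldr madd [::] W) beta.
  move=> sT sW; have eW j : nth 0 (ssyt_weight (destandardize (T, W))) j =
      nth 0 (foldr madd [::] W) j.
    by rewrite /ssyt_weight !nth_foldr_madd (perm_big _ (destandardize_perm sT sW)).
  by apply/meqP/meqP => eb j; rewrite -eb.
have mid_c : has_card (mid_pred n lam beta) c.
  apply: (has_card_bij (f := destandardize)) lhs_c => [[T W]|[T W] [T' W']|t].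
  - case/and5P=> sT /eqP sW cW compW wW.
    by rewrite /lhs_pred (destandardize_ssyt lam_part sT sW compW cW) weightE.
  - case/and5P=> sT /eqP sW _ compW _ /and5P[sT' /eqP sW' _ compW' _].
    exact: destandardize_inj sT sT' sW sW' compW compW'.
  case/andP=> /(destandardize_surj lam_part)[T [W [sT sW cW compW <-]]].
  rewrite weightE // => wW; exists (T, W) => //.
  by apply/and5P; split=> //; apply/eqP.
(* The second bijection keeps [T], whose descent set is the [R] used for decoding, and trades [L]
   and [J] for [W]. *)
apply: (has_card_bij (f := fun x => let: (T, L, J) := x in
  (T, decode (des n T) n (size beta).+1 L J))) mid_c => [[[T L] J]||[T W]].
- case/and4P=> sT vL vJ QJ; apply/and5P; split=> //.
  + by rewrite size_map size_iota.
  + by apply/allP=> _ /mapP[v _ ->]; rewrite /canon trim_id.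
  + exact: decode_compat.
  apply/meqP=> j; rewrite nth_sum_decode //; move/meqP: QJ => QJ.
  by case: ltnP => jb; [apply: QJ | rewrite nth_default // ltnW].
- move=> [[T L] J] [[T' L'] J'] /and4P[_ vL vJ QJ] /and4P[_ vL' vJ' QJ'] [eT eW].
  move: eT vL' QJ' eW => <- vL' QJ' eW.
  by have [-> ->] := decode_inj n_gt0 vL vJ QJ vL' vJ' QJ' eW.
case/and5P=> sT /eqP sW cW compW wW.
have [L [J [vL vJ QJ <-]]] := decode_surj n_gt0 sW cW compW wW.
by exists (T, L, J) => //; apply/and4P; split.
Qed.
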